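(* Let $T\ge 1$ be an integer and $0<\epsilon<1$. For the symmetric two-armed Bernoulli bandit with centered rewards and horizon $T$, the myopic player $p^m$ is a minimizer over all player strategies $p$ of the worst-case regret $$\max_{j\in\{1,2\}} R_T(p,a(j)),$$ and it is also a minimizer over all player strategies $p$ of the worst-case pseudoregret $$\max_{j\in\{1,2\}} \bar R_T(p,a(j)).$$ Moreover, $R_T(p^m,a(1)) = R_T(p^m,a(2))$ and $\bar R_T(p^m,a(1)) = \bar R_T(p^m,a(2))$.
   Context: Symmetric two-armed Bernoulli bandit with centered rewards. Time runs over $t=-T,-T+1,\dots,-1$. For $j\in\{1,2\}$, $a(j)$ denotes the following pair of reward distributions: the safe arm $j$ gives reward $+1$ with probability $\frac{1+\epsilon}{2}$ and $-1$ with probability $\frac{1-\epsilon}{2}$; the other (risky) arm gives reward $+1$ with probability $\frac{1-\epsilon}{2}$ and $-1$ with probability $\frac{1+\epsilon}{2}$. The rewards of the two arms are independent of each other and of the history. In each period $t$ the player selects a probability distribution $p_t=(p_{1,t},p_{2,t})$ on $\{1,2\}$; then $g_t=(g_{1,t},g_{2,t})$ is sampled from $a(j)$ and, independently of $g_t$, the arm $I_t\in\{1,2\}$ is sampled from $p_t$. Only $I_t$ and $g_{I_t,t}$ are revealed to the player. A player strategy is $p=(p_{-T},\dots,p_{-1})$, where each $p_t$ is an arbitrary function of the history $H_{t-1}=(I_{-T},\dots,I_{t-1};\,g_{I_{-T},-T},\dots,g_{I_{t-1},t-1})$ (and $p_{-T}$ is a fixed distribution). The player does not know $j$. Regret and pseudoregret: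 $$R_T(p,a(j)) = \mathbb E_{p,a(j)}\Big[\max_{i\in\{1,2\}} \sum_{t=-T}^{-1}(g_{i,t}-g_{I_t,t})\Big],\qquad \bar R_T(p,a(j)) = \max_{i\in\{1,2\}} \mathbb E_{p,a(j)}\Big[\sum_{t=-T}^{-1}(g_{i,t}-g_{I_t,t})\Big].$$ Myopic player: let $\xi^r_t = \sum_{\tau<t}\big(g_{1,\tau}\mathbf 1_{\{I_\tau=1\}} - g_{2,\tau}\mathbf 1_{\{I_\tau=2\}}\big)$ (sum over $-T\le\tau<t$). The myopic player $p^m$ uses at time $t$ the distribution $(1,0)$ if $\xi^r_t>0$, $(\frac12,\frac12)$ if $\xi^r_t=0$, and $(0,1)$ if $\xi^r_t<0$. *)

(* Defs.v *)
From HB Require Import structures.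
From mathcomp Require Import all_boot all_order all_algebra.
Set Implicit Arguments.
Unset Strict Implicit.
Unset Printing Implicit Defensive.
Import Order.TTheory GRing.Theory Num.Theory.
Local Open Scope ring_scope.

(** Symmetric two-armed Bernoulli bandit with centered rewards (MathComp).

    Step [s : 'I_T] stands for the period t = s - T, so that s = 0, ..., T - 1
    corresponds to t = -T, ..., -1.  Everything lives on the finite sample
    space of T.-tuples of one-period outcomes, so probabilities and
    expectations are finite sums, over an arbitrary ordered field R. *)

Notation arm := 'I_2.
Definition arm1 : arm := ord0.
Definition arm2 : arm := ord_max.

Definition max_arm (R : realFieldType) (F : arm -> R) : R :=
  Num.max (F arm1) (F arm2).

(* A reward is encoded by its sign: [true] is +1 and [false] is -1. *)
Definition rew (R : realFieldType) (b : bool) : R := if b then 1 else - 1.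

(* Law of the reward of arm [i] under a(j), where [j] is the safe arm. *)
Definition arm_law (R : realFieldType) (eps : R) (j i : arm) (b : bool) : R :=
  if i == j then (if b then (1 + eps) / 2 else (1 - eps) / 2)
  else (if b then (1 - eps) / 2 else (1 + eps) / 2).

(* Joint law of the rewards (g_1, g_2) of one period: the arms are independent. *)
Definition reward_law (R : realFieldType) (eps : R) (j : arm)
    (g : {ffun arm -> bool}) : R :=
  \prod_(i : arm) arm_law eps j i (g i).

(* The observed pairs (I_t, g_{I_t,t}), in chronological order. *)
Definition history := seq (arm * bool).

(* Outcome (g_t, I_t) of one period. *)
Definition outcome := ({ffun arm -> bool} * arm)%type.

Definition observe (w : seq outcome) : history :=
  [seq (o.2, o.1 o.2) | o : outcome <- w].

(* [p h i] is the probability of selecting arm [i] after history [h].  The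
   period is determined by [size h], so [p] may depend on time; the values of
   [p] on histories of length at least T are never used. *)
Definition is_strategy (R : realFieldType) (p : history -> arm -> R) : Prop :=
  forall h : history, (forall i : arm, 0 <= p h i) /\ \sum_(i : arm) p h i = 1.

(* Probability of the sample path [w]: in each period I_t is drawn from p_t
   given the past observations, and g_t from a(j), independently of I_t and of
   the past. *)
Definition path_prob (R : realFieldType) (eps : R) (T : nat)
    (p : history -> arm -> R) (j : arm) (w : T.-tuple outcome) : R :=
  \prod_(s < T) (p (observe (take s w)) (tnth w s).2
                 * reward_law eps j (tnth w s).1).

Definition expect (R : realFieldType) (eps : R) (T : nat)
    (p : history -> arm -> R) (j : arm) (X : T.-tuple outcome -> R) : R :=
  \sum_(w : T.-tuple outcome) path_prob eps p j w * X w.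

(* The sum over t of g_{i,t} - g_{I_t,t}. *)
Definition path_regret (R : realFieldType) (T : nat) (i : arm)
    (w : T.-tuple outcome) : R :=
  \sum_(s < T) (rew R ((tnth w s).1 i) - rew R ((tnth w s).1 (tnth w s).2)).

Definition regret (R : realFieldType) (eps : R) (T : nat)
    (p : history -> arm -> R) (j : arm) : R :=
  expect eps p j (fun w : T.-tuple outcome =>
    max_arm (fun i => path_regret R i w)).

Definition pseudoregret (R : realFieldType) (eps : R) (T : nat)
    (p : history -> arm -> R) (j : arm) : R :=
  max_arm (fun i =>
    expect eps p j (fun w : T.-tuple outcome => path_regret R i w)).

(* xi^r_t as a function of the history up to t - 1. *)
Definition xi (R : realFieldType) (h : history) : R :=
  \sum_(x <- h) (rew R x.2 * (x.1 == arm1)%:R - rew R x.2 * (x.1 == arm2)%:R).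

Definition myopic (R : realFieldType) (h : history) (i : arm) : R :=
  if 0 < xi R h then (i == arm1)%:R
  else if xi R h == 0 then 1 / 2
  else (i == arm2)%:R.

Definition minimizes_over_strategies (R : realFieldType)
    (L : (history -> arm -> R) -> R) (p0 : history -> arm -> R) : Prop :=
  is_strategy p0 /\ forall p, is_strategy p -> L p0 <= L p.

(* Main.v *)
Require Import Defs.
From HB Require Import structures.
From mathcomp Require Import all_boot all_order all_algebra.
From mathcomp Require Import ring lra.
Set Implicit Arguments.
Unset Strict Implicit.
Unset Printing Implicit Defensive.
Import Order.TTheory GRing.Theory Num.Theory.
Local Open Scope ring_scope.

(** Both regrets equal a term that depends on the rewards alone, hence not on
    the strategy, minus the expected gain of the player.  A pull of arm 1 with
    reward g and a pull of arm 2 with reward -g carry the same information about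
    j, and they have the same law under each a(j), so the choice of arm does not
    influence what is learned.  Under the uniform prior on j it is therefore
    optimal to maximize the expected immediate gain given the history, which is
    what the myopic player does: the log-likelihood ratio of a(1) against a(2)
    is a positive multiple of xi.  The exchange of the two arms shows that the
    myopic player has the same regret under a(1) and a(2), so that its worst
    case is its Bayes average, and the Bayes average of any other player is at
    most the worst case of that player. *)

Lemma max_armBr (R : realFieldType) (F : arm -> R) (c : R) :
  max_arm (fun i => F i - c) = max_arm F - c.
Proof. by rewrite /max_arm addr_maxl. Qed.

Lemma eq_max_arm (R : realFieldType) (F G : arm -> R) :
  F =1 G -> max_arm F = max_arm G.
Proof. by move=> FG; rewrite /max_arm !FG. Qed.

Lemma max_armC (R : realFieldType) (F : arm -> R) :
  max_arm (F \o @rev_ord 2) = max_arm F.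
Proof.
rewrite /max_arm /= maxC; congr (Num.max (F _) (F _)); exact: val_inj.
Qed.

Lemma sum_arm (R : realFieldType) (F : arm -> R) :
  \sum_i F i = F arm1 + F arm2.
Proof. by rewrite big_ord_recr big_ord1; congr (F _ + F _); apply: val_inj. Qed.

Lemma sum_tuple_cons (R : realFieldType) (A : finType) (T : nat)
    (F : T.+1.-tuple A -> R) :
  \sum_w F w = \sum_a \sum_(w : T.-tuple A) F [tuple of a :: w].
Proof.
rewrite pair_big /=.
rewrite (reindex (fun u : A * T.-tuple A => [tuple of u.1 :: u.2])) //=.
exists (fun w => (thead w, [tuple of behead w])) => [[a w]|w] _ /=.
  by congr (_, _); apply: val_inj.
by rewrite [RHS]tuple_eta.
Qed.

(** * Expectation under a strategy, by recursion on the first period *)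

Section Bandit.
Variables (R : realFieldType) (eps : R).
Implicit Types (p q : history -> arm -> R) (i j : arm) (h : history).

(** The strategy that remains once [x] has been observed first. Peeling periods off the front makes
    every later induction one on the horizon. *)
Definition shift p (x : arm * bool) : history -> arm -> R :=
  fun h => p (x :: h).

Lemma is_strategy_shift p x : is_strategy p -> is_strategy (shift p x).
Proof. by move=> sp h; apply: sp. Qed.

Lemma myopic_strategy : is_strategy (@myopic R).
Proof.
move=> h; split=> [i|]; rewrite /myopic ?sum_arm.
  by case: ifP => _; [|case: ifP => _]; rewrite ?ler0n // divr_ge0 ?ler0n.
by case: ifP => _; [|case: ifP => _]; rewrite /= ?addr0 ?add0r //; field.
Qed.

Lemma eq_expect (T : nat) p q j (X Y : T.-tuple outcome -> R) :
  (forall h, p h =1 q h) -> X =1 Y -> expect eps p j X = expect eps q j Y.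
Proof.
move=> pq XY; apply: eq_bigr => w _; rewrite XY; congr (_ * _).
by apply: eq_bigr => s _; rewrite pq.
Qed.

Lemma expectD (T : nat) p j (X Y : T.-tuple outcome -> R) :
  expect eps p j (fun w => X w + Y w) = expect eps p j X + expect eps p j Y.
Proof. by rewrite -big_split; apply: eq_bigr => w _; rewrite mulrDr. Qed.

Lemma expectB (T : nat) p j (X Y : T.-tuple outcome -> R) :
  expect eps p j (fun w => X w - Y w) = expect eps p j X - expect eps p j Y.
Proof.
by rewrite -sumrB; apply: eq_bigr => w _; rewrite mulrBr.
Qed.

Lemma path_prob_cons (T : nat) p j (o : outcome) (w : T.-tuple outcome) :
  path_prob eps p j [tuple of o :: w] =
  p [::] o.2 * reward_law eps j o.1
  * path_prob eps (shift p (o.2, o.1 o.2)) j w.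
Proof.
rewrite /path_prob big_ord_recl /= tnth0; congr (_ * _).
by apply: eq_bigr => s _; rewrite tnthS.
Qed.

Lemma expectS (T : nat) p j (X : T.+1.-tuple outcome -> R) :
  expect eps p j X =
  \sum_(o : outcome) p [::] o.2 * reward_law eps j o.1
    * expect eps (shift p (o.2, o.1 o.2)) j
        (fun w : T.-tuple outcome => X [tuple of o :: w]).
Proof.
rewrite /expect sum_tuple_cons; apply: eq_bigr => o _.
rewrite mulr_sumr; apply: eq_bigr => w _.
by rewrite path_prob_cons mulrA.
Qed.

Lemma expect0 p j (X : 0.-tuple outcome -> R) :
  expect eps p j X = X [tuple].
Proof.
rewrite /expect (eq_bigr (fun=> X [tuple])); last first.
  by move=> w _; rewrite /path_prob big_ord0 mul1r tuple0.
by rewrite sumr_const card_tuple expn0 mulr1n.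
Qed.

Lemma sum_arm_law j i : \sum_b arm_law eps j i b = 1.
Proof. by rewrite big_bool /arm_law; case: eqP => _ /=; field. Qed.

Lemma reward_law_marginal j i (f : bool -> R) :
  \sum_g reward_law eps j g * f (g i) = \sum_b arm_law eps j i b * f b.
Proof.
(* [F] carries [f] on coordinate [i] only. The sum over [g] of a product then becomes a product of
   sums, and the factor of the other arm is 1. *)
pose F k b := arm_law eps j k b * (if k == i then f b else 1).
transitivity (\sum_(g : {ffun arm -> bool}) \prod_k F k (g k)).
  apply: eq_bigr => g _; rewrite big_split /=; congr (_ * _).
  by rewrite -big_mkcond big_pred1_eq.
rewrite -bigA_distr_bigA (bigD1 i) //= [X in _ * X]big1 => [|k /negbTE ki].
  by rewrite mulr1; apply: eq_bigr => b _; rewrite /F eqxx.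
rewrite -[RHS](sum_arm_law j k).
by apply: eq_bigr => b _; rewrite /F ki mulr1.
Qed.

Lemma reward_law_total j : \sum_g reward_law eps j g = 1.
Proof.
rewrite -(sum_arm_law j j) -[RHS](eq_bigr _ (fun b _ => mulr1 _)).
rewrite -reward_law_marginal; apply: eq_bigr => g _; exact/esym/mulr1.
Qed.

Lemma expect_const (T : nat) p j (c : R) : is_strategy p ->
  expect eps p j (fun _ : T.-tuple outcome => c) = c.
Proof.
elim: T p => [|T IH] p sp; first by rewrite expect0.
rewrite expectS.
rewrite (eq_bigr (fun o => p [::] o.2 * reward_law eps j o.1 * c)); last first.
  by move=> o _; rewrite IH //; apply: is_strategy_shift.
rewrite -mulr_suml -(pair_bigA _ (fun g i => p [::] i * reward_law eps j g)) /=.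
under eq_bigr => g _ do rewrite -mulr_suml (sp [::]).2 mul1r.
by rewrite reward_law_total mul1r.
Qed.

(** In each period [g] is drawn independently of the arm and of the past, so the reward vectors have
    the same law under every strategy. *)
Lemma expect_rewards_only (T : nat) p q j (X : T.-tuple outcome -> R) :
  is_strategy p -> is_strategy q ->
  (forall w w' : T.-tuple outcome,
     map fst w = map fst w' -> X w = X w') ->
  expect eps p j X = expect eps q j X.
Proof.
elim: T p q X => [|T IH] p q X sp sq HX; first by rewrite !expect0.
(* [myopic] and [arm1] are arbitrary representatives: the induction hypothesis lets the continuation
   be replaced, and [HX] the arm. *)
pose K g := reward_law eps j g
  * expect eps (@myopic R) j (fun w => X [tuple of (g, arm1) :: w]).
suff E r : is_strategy r -> expect eps r j X = \sum_g K g by rewrite !E.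
move=> sr; rewrite expectS.
transitivity (\sum_(o : outcome) r [::] o.2 * K o.1).
  apply: eq_bigr => -[g i] _; rewrite /K /= -mulrA; congr (_ * (_ * _)).
  rewrite (IH _ (@myopic R)).
  - by apply: eq_expect => // w; apply: HX.
  - exact: is_strategy_shift.
  - exact: myopic_strategy.
  - by move=> w w' ww'; apply: HX; rewrite /= ww'.
rewrite -(pair_bigA _ (fun g i => r [::] i * K g)) /=.
by apply: eq_bigr => g _; rewrite -mulr_suml (sr [::]).2 mul1r.
Qed.

(** * Regret as a strategy-free term minus the player's gain *)

Definition arm_gain (T : nat) i (w : T.-tuple outcome) : R :=
  \sum_(o <- w) rew R (o.1 i).

Definition player_gain (T : nat) (w : T.-tuple outcome) : R :=
  \sum_(o <- w) rew R (o.1 o.2).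

Lemma path_regretE (T : nat) i (w : T.-tuple outcome) :
  path_regret R i w = arm_gain i w - player_gain w.
Proof. by rewrite /arm_gain /player_gain !big_tuple -sumrB. Qed.

Lemma arm_gain_rewards_only (T : nat) i (w w' : T.-tuple outcome) :
  map fst w = map fst w' -> arm_gain i w = arm_gain i w'.
Proof.
move=> ww'; rewrite /arm_gain.
by rewrite -!(big_map fst xpredT (fun g : {ffun arm -> bool} => rew R (g i))) ww'.
Qed.

Lemma regretE (T : nat) p j : is_strategy p ->
  regret eps T p j =
  expect eps (@myopic R) j
    (fun w : T.-tuple outcome => max_arm (fun i => arm_gain i w))
  - expect eps p j (@player_gain T).
Proof.
move=> sp; rewrite (expect_rewards_only j myopic_strategy sp); last first.
  by move=> w w' ww'; apply: eq_max_arm => i; apply: arm_gain_rewards_only.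
rewrite -expectB; apply: eq_expect => // w.
by rewrite -max_armBr; apply: eq_max_arm => i; apply: path_regretE.
Qed.

Lemma pseudoregretE (T : nat) p j : is_strategy p ->
  pseudoregret eps T p j =
  max_arm (fun i => expect eps (@myopic R) j (@arm_gain T i))
  - expect eps p j (@player_gain T).
Proof.
move=> sp; rewrite -max_armBr; apply: eq_max_arm => i.
rewrite (expect_rewards_only j myopic_strategy sp); last first.
  exact: arm_gain_rewards_only.
by rewrite -expectB; apply: eq_expect => // w; apply: path_regretE.
Qed.

(** * The exchange of the two arms *)

Definition swap_rewards (g : {ffun arm -> bool}) : {ffun arm -> bool} :=
  [ffun i => g (rev_ord i)].

Definition swap_outcome (o : outcome) : outcome :=
  (swap_rewards o.1, rev_ord o.2).

Definition swap_history h : history := [seq (rev_ord x.1, x.2) | x <- h].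

Lemma swap_outcomeK : involutive swap_outcome.
Proof.
case=> g i; congr (_, _); last exact: rev_ordK.
by apply/ffunP => k; rewrite !ffunE rev_ordK.
Qed.

Lemma swap_reward_law j g :
  reward_law eps (rev_ord j) (swap_rewards g) = reward_law eps j g.
Proof.
rewrite /reward_law (reindex_inj rev_ord_inj); apply: eq_bigr => i _.
by rewrite ffunE rev_ordK /arm_law (inj_eq rev_ord_inj).
Qed.

(** Relabelling the arms is a bijection of the sample space carrying a(j) to the other environment;
    the strategy gets conjugated by the relabelling. *)
Lemma expect_swap (T : nat) p j (X : T.-tuple outcome -> R) :
  expect eps p (rev_ord j) X =
  expect eps (fun h i => p (swap_history h) (rev_ord i)) j
    (fun w => X [tuple of map swap_outcome w]).
Proof.
rewrite /expect (reindex_inj (h := fun w : T.-tuple outcome =>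
  [tuple of map swap_outcome w])); last first.
  move=> w w' /(congr1 val) /= ww'; apply: val_inj.
  exact: (inj_map (can_inj swap_outcomeK)).
apply: eq_bigr => w _; congr (_ * _); apply: eq_bigr => s _.
rewrite !tnth_map swap_reward_law -map_take; congr (p _ _ * _).
rewrite /observe /swap_history -!map_comp; apply: eq_map => o /=.
by rewrite ffunE rev_ordK.
Qed.

Lemma xi_swap h : xi R (swap_history h) = - xi R h.
Proof.
rewrite /xi /swap_history big_map -sumrN; apply: eq_bigr => -[i b] _ /=.
by case: (i) => -[|[|//]] ? /=; ring.
Qed.

Lemma myopic_swap h i :
  myopic R (swap_history h) (rev_ord i) = myopic R h i.
Proof.
rewrite /myopic xi_swap oppr_gt0 oppr_eq0.
by case: ltgtP => _ //; case: (i) => -[|[|//]] ? /=.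
Qed.

Lemma expect_myopic_swap (T : nat) j (X : T.-tuple outcome -> R) :
  expect eps (@myopic R) (rev_ord j) X =
  expect eps (@myopic R) j (fun w => X [tuple of map swap_outcome w]).
Proof.
by rewrite expect_swap; apply: eq_expect => // h i; apply: myopic_swap.
Qed.

Lemma path_regret_swap (T : nat) i (w : T.-tuple outcome) :
  path_regret R i [tuple of map swap_outcome w] = path_regret R (rev_ord i) w.
Proof.
by apply: eq_bigr => s _; rewrite !tnth_map !ffunE rev_ordK.
Qed.

Lemma regret_myopic_swap (T : nat) j :
  regret eps T (@myopic R) (rev_ord j) = regret eps T (@myopic R) j.
Proof.
rewrite /regret expect_myopic_swap; apply: eq_expect => // w.
rewrite -[RHS]max_armC; apply: eq_max_arm => i; exact: path_regret_swap.
Qed.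

Lemma pseudoregret_myopic_swap (T : nat) j :
  pseudoregret eps T (@myopic R) (rev_ord j) = pseudoregret eps T (@myopic R) j.
Proof.
rewrite /pseudoregret -[RHS]max_armC; apply: eq_max_arm => i.
rewrite expect_myopic_swap; apply: eq_expect => // w; exact: path_regret_swap.
Qed.

(** * Dynamic programming for the Bayes gain *)

Lemma player_gainS (T : nat) p j : is_strategy p ->
  expect eps p j (@player_gain T.+1) =
  \sum_i p [::] i * \sum_b arm_law eps j i b
    * (rew R b + expect eps (shift p (i, b)) j (@player_gain T)).
Proof.
move=> sp; rewrite expectS.
pose f i b := rew R b + expect eps (shift p (i, b)) j (@player_gain T).
transitivity (\sum_(o : outcome)
    p [::] o.2 * reward_law eps j o.1 * f o.2 (o.1 o.2)).
  apply: eq_bigr => -[g i] _ /=; congr (_ * _); rewrite /f.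
  (* The immediate reward is constant over the remaining periods, so it can be moved under their
     expectation. *)
  rewrite -(@expect_const T (shift p (i, g i)) j (rew R (g i))); last first.
    exact: is_strategy_shift.
  rewrite -expectD; apply: eq_expect => // w.
  by rewrite /player_gain big_cons.
rewrite -(pair_bigA _ (fun g i => p [::] i * reward_law eps j g * f i (g i))) /=.
rewrite exchange_big; apply: eq_bigr => i _ /=.
rewrite -reward_law_marginal mulr_sumr.
by apply: eq_bigr => g _; rewrite mulrA.
Qed.

(** The weights [a] and [b] are prior times likelihood, left unnormalized so that an observation
    just multiplies them. *)
Definition bayes_gain (T : nat) p (a b : R) : R :=
  a * expect eps p arm1 (@player_gain T) + b * expect eps p arm2 (@player_gain T).

Notation u := ((1 + eps) / 2).
Notation v := ((1 - eps) / 2).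

(** The Bellman recursion. The weighted mean reward is eps (a - b) for arm 1 and its opposite for
    arm 2, so the better arm yields [eps * |a - b|]. *)
Fixpoint bayes_value (T : nat) (a b : R) : R :=
  if T is T'.+1 then
    eps * `|a - b| + bayes_value T' (a * u) (b * v)
    + bayes_value T' (a * v) (b * u)
  else 0.

Lemma bayes_gain0 p a b : bayes_gain 0 p a b = 0.
Proof.
by rewrite /bayes_gain !expect0 /player_gain !big_nil !mulr0 addr0.
Qed.

(* Whichever arm is pulled, the two possible observations update the weights
   (a, b) to (a u, b v) and (a v, b u): exploration is pointless. *)
Lemma bayes_gainS (T : nat) p a b : is_strategy p ->
  bayes_gain T.+1 p a b =
  eps * (a - b) * (p [::] arm1 - p [::] arm2)
  + p [::] arm1 * (bayes_gain T (shift p (arm1, true)) (a * u) (b * v)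
                   + bayes_gain T (shift p (arm1, false)) (a * v) (b * u))
  + p [::] arm2 * (bayes_gain T (shift p (arm2, false)) (a * u) (b * v)
                   + bayes_gain T (shift p (arm2, true)) (a * v) (b * u)).
Proof.
move=> sp; rewrite /bayes_gain !player_gainS // !sum_arm !big_bool /=.
rewrite /arm_law /rew /=.
by field.
Qed.

(** The continuations after either arm have the same bound by induction, so their weights
    [x + y = 1] merge; the immediate term is bounded since |x - y| is at most 1. *)
Lemma bayes_gain_le (T : nat) p a b : 0 <= eps -> is_strategy p ->
  bayes_gain T p a b <= bayes_value T a b.
Proof.
move=> eps0; elim: T p a b => [|T IH] p a b sp; first by rewrite bayes_gain0.
rewrite bayes_gainS //=.
have [p0 p1] := sp [::]; rewrite sum_arm in p1.
have x0 := p0 arm1; have y0 := p0 arm2.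
set x := p [::] arm1 in p1 x0 *; set y := p [::] arm2 in p1 y0 *.
have A z c d := IH _ c d (is_strategy_shift z sp).
have B : eps * (a - b) * (x - y) <= eps * `|a - b|.
  rewrite -mulrA ler_wpM2l // (le_trans (ler_norm _)) // normrM.
  by rewrite ler_piMr // ler_norml; lra.
have C := ler_wpM2l x0
  (lerD (A (arm1, true) (a * u) (b * v)) (A (arm1, false) (a * v) (b * u))).
have D := ler_wpM2l y0
  (lerD (A (arm2, false) (a * u) (b * v)) (A (arm2, true) (a * v) (b * u))).
apply: le_trans (lerD (lerD B C) D) _.
by rewrite -addrA -mulrDl p1 mul1r addrA.
Qed.

(** * The myopic player attains the Bayes value *)

Lemma xi_rcons h x : xi R (rcons h x) =
  xi R h + (rew R x.2 * (x.1 == arm1)%:R - rew R x.2 * (x.1 == arm2)%:R).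
Proof. by rewrite /xi big_rcons. Qed.

(** Exchanging m and n flips both signs. For n at most m, the positive factor (x y)^n splits off and
    leaves x^k - y^k with k = m - n. *)
Lemma sgr_weights (x y : R) (m n : nat) : 0 < y -> y < x ->
  Num.sg (x ^+ m * y ^+ n - y ^+ m * x ^+ n) = Num.sg (m%:R - n%:R : R).
Proof.
move=> y0 yx; have x0 := lt_trans y0 yx.
wlog mn : m n / (n <= m)%N => [W|].
  have [/W //|/ltnW/W E] := leqP n m.
  by rewrite -[LHS]opprK -sgrN opprB [X in X - _]mulrC [X in _ - X]mulrC E -sgrN opprB.
rewrite -(subnK mn); set k := (m - n)%N.
have -> : x ^+ (k + n) * y ^+ n - y ^+ (k + n) * x ^+ n
    = (x ^+ k - y ^+ k) * (x ^+ n * y ^+ n) by rewrite !exprD; ring.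
rewrite natrD addrK sgrM [X in _ * X]gtr0_sg ?mulr_gt0 ?exprn_gt0 // mulr1.
case: k => [|k]; first by rewrite !expr0 subrr.
by rewrite !gtr0_sg ?ltr0n // subr_gt0 ltrXn2r // ltW.
Qed.

Lemma myopic_greedy h (d : R) : Num.sg d = Num.sg (xi R h) ->
  d * (myopic R h arm1 - myopic R h arm2) = `|d|.
Proof.
rewrite /myopic; have [xi0|xi0|<-] := ltgtP 0 (xi R h).
- by rewrite (gtr0_sg xi0) => /eqP; rewrite sgr_cp0 => /gtr0_norm -> /=; ring.
- by rewrite (ltr0_sg xi0) => /eqP; rewrite sgr_cp0 => /ltr0_norm -> /=; ring.
- by rewrite sgr0 => /eqP; rewrite sgr_eq0 => /eqP ->; rewrite normr0 mul0r.
Qed.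

(* After history h the likelihoods of h under a(1) and a(2) are, up to a common
   factor, u^m v^n and v^m u^n with m - n = xi h. *)
Lemma bayes_gain_myopic (T : nat) h p (m n : nat) :
  0 < eps -> eps < 1 -> is_strategy p ->
  (forall h', p h' =1 myopic R (h ++ h')) -> xi R h = m%:R - n%:R ->
  bayes_gain T p (u ^+ m * v ^+ n) (v ^+ m * u ^+ n) =
  bayes_value T (u ^+ m * v ^+ n) (v ^+ m * u ^+ n).
Proof.
move=> eps0 eps1; elim: T h p m n => [|T IH] h p m n sp pE xiE.
  by rewrite bayes_gain0.
have v0 : 0 < v by lra.
have vu : v < u by lra.
rewrite bayes_gainS //=.
have shiftE x h' : shift p x h' =1 myopic R (rcons h x ++ h').
  by move=> i; rewrite /shift pE cat_rcons.
(* An observation that raises [xi] by 1 turns m into m + 1; one that lowers it, treated in [down],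
   turns n into n + 1. *)
have up x : rew R x.2 * (x.1 == arm1)%:R - rew R x.2 * (x.1 == arm2)%:R = 1 ->
    bayes_gain T (shift p x) (u ^+ m * v ^+ n * u) (v ^+ m * u ^+ n * v)
    = bayes_value T (u ^+ m * v ^+ n * u) (v ^+ m * u ^+ n * v).
  move=> x1; rewrite [_ ^+ m * _ * _]mulrAC -exprSr [_ ^+ m * _ * _]mulrAC -exprSr.
  apply: IH (is_strategy_shift x sp) (shiftE x) _.
  by rewrite xi_rcons x1 xiE -natr1; ring.
have down x :
    rew R x.2 * (x.1 == arm1)%:R - rew R x.2 * (x.1 == arm2)%:R = - 1 ->
    bayes_gain T (shift p x) (u ^+ m * v ^+ n * v) (v ^+ m * u ^+ n * u)
    = bayes_value T (u ^+ m * v ^+ n * v) (v ^+ m * u ^+ n * u).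
  move=> x1; rewrite -!mulrA -!exprSr.
  apply: IH (is_strategy_shift x sp) (shiftE x) _.
  by rewrite xi_rcons x1 xiE -natr1; ring.
rewrite !up ?down /=; try ring.
have := (sp [::]).2; rewrite sum_arm => p1.
rewrite -[LHS]addrA -mulrDl p1 mul1r addrA -mulrA !pE cats0.
by rewrite myopic_greedy // xiE sgr_weights.
Qed.

(** * From Bayes optimality to minimax *)

Lemma myopic_max_total_gain (T : nat) p :
  0 < eps -> eps < 1 -> is_strategy p ->
  expect eps p arm1 (@player_gain T) + expect eps p arm2 (@player_gain T)
  <= expect eps (@myopic R) arm1 (@player_gain T)
     + expect eps (@myopic R) arm2 (@player_gain T).
Proof.
move=> eps0 eps1 sp.
(* At the empty history m = n = 0, and the weights (1, 1) are the uniform prior up to a factor 2. *)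
have := @bayes_gain_myopic T [::] (@myopic R) 0 0 eps0 eps1 myopic_strategy.
rewrite !expr0 mulr1 /xi big_nil subrr => /(_ (fun _ _ => erefl) erefl) E.
have := bayes_gain_le T 1 1 (ltW eps0) sp.
by rewrite -E /bayes_gain !mul1r.
Qed.

(** [L] stands for either kind of regret, and [G] for its strategy-free term. *)
Lemma myopic_minimax (T : nat) (L : (history -> arm -> R) -> arm -> R)
    (G : arm -> R) :
  0 < eps -> eps < 1 ->
  (forall p j, is_strategy p -> L p j = G j - expect eps p j (@player_gain T)) ->
  L (@myopic R) arm1 = L (@myopic R) arm2 ->
  minimizes_over_strategies (fun p => max_arm (L p)) (@myopic R).
Proof.
move=> eps0 eps1 LE Lm; split=> [|p sp]; first exact: myopic_strategy.
have := myopic_max_total_gain T eps0 eps1 sp.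
move: Lm; rewrite /max_arm => Lm; rewrite Lm maxxx.
move: Lm; rewrite !LE //; try exact: myopic_strategy.
move=> Lm V; rewrite le_max; apply/orP.
(* If [p] does strictly better than the common myopic value under a(1), the bound on the summed
   gains forces it to do no better under a(2). *)
case: (lerP (G arm2 - expect eps (@myopic R) arm2 (@player_gain T))
            (G arm1 - expect eps p arm1 (@player_gain T))) => H; first by left.
by right; lra.
Qed.

End Bandit.

Theorem mainTheorem1 (R : realFieldType) (T : nat) (eps : R)
    (hT : (1 <= T)%N) (heps0 : 0 < eps) (heps1 : eps < 1) :
  [/\ minimizes_over_strategies
        (fun p => max_arm (fun j => regret eps T p j)) (@myopic R),
      minimizes_over_strategies
        (fun p => max_arm (fun j => pseudoregret eps T p j)) (@myopic R),
      regret eps T (@myopic R) arm1 = regret eps T (@myopic R) arm2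
    & pseudoregret eps T (@myopic R) arm1
      = pseudoregret eps T (@myopic R) arm2].
Proof.
have arm2E : arm2 = rev_ord arm1 by exact: val_inj.
have Er : regret eps T (@myopic R) arm1 = regret eps T (@myopic R) arm2.
  by rewrite arm2E regret_myopic_swap.
have Ep : pseudoregret eps T (@myopic R) arm1
    = pseudoregret eps T (@myopic R) arm2.
  by rewrite arm2E pseudoregret_myopic_swap.
split=> //.
- exact: (myopic_minimax heps0 heps1 (@regretE _ _ T) Er).
- exact: (myopic_minimax heps0 heps1 (@pseudoregretE _ _ T) Ep).
Qed.
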